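(* Let $(\Delta,[\![\ ,\ ]\!])$ be a regular cleft extension on a standard differential graded algebra $\Omega=\Omega(A)$, with associated interior product $\mathfrak j$ and metric inner product $(\ ,\ )$. Then $\mathfrak j$ is a bimodule map and $$\nabla_\omega\eta=\tfrac12[\![\omega,\eta]\!],\qquad\omega\in\Omega^1,\ \eta\in\Omega,$$ is a bimodule covariant derivative on $\Omega$ with respect to $(\ ,\ )$, with $$\sigma:\Omega^1\otimes_A\Omega\otimes_A\Omega^1\to\Omega,\qquad\sigma_\omega(\eta\otimes_A\zeta)=\mathfrak j_{\omega\eta}(\zeta)+\omega\,\mathfrak j_\eta(\zeta),\qquad\omega,\zeta\in\Omega^1,\ \eta\in\Omega.$$ Moreover, if $(\ ,\ )$ is invertible with metric $g=g^1\otimes g^2$, then $\nabla_\omega$ acts on tensor products, by the well-defined formula on $\Omega\otimes_A\Omega$ $$\nabla_\omega(\eta\otimes_A\zeta)=\nabla_\omega\eta\otimes_A\zeta+\sigma_\omega(\eta\otimes_Ag^1)\otimes_A\nabla_{g^2}\zeta,\qquad\eta,\zeta\in\Omega.$$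
   Context: $A$ is a unital algebra over a field $k$ of characteristic $\ne2$. A DGA on $A$ is an associative graded algebra $\Omega=\oplus_{n\ge0}\Omega^n$ with $\Omega^0=A$ and a graded derivation $\mathrm d$ of degree $1$, $\mathrm d^2=0$. It is standard if $\Omega^1$ is spanned by elements $a\,\mathrm db$ and $\Omega$ is generated by degrees $0,1$. A (central extension) cocycle on $\Omega$ is a pair of a degree $0$ linear map $\Delta:\Omega\to\Omega$ and a degree $-1$ bilinear map $[\![\ ,\ ]\!]$ on $\Omega$ with $[\Delta,\mathrm d]=0$ and, for all $\omega,\eta,\zeta\in\Omega$, $[\![\omega\eta,\zeta]\!]+[\![\omega,\eta]\!]\zeta=[\![\omega,\eta\zeta]\!]+(-1)^{|\omega|}\omega[\![\eta,\zeta]\!]$ and $\Delta(\omega\eta)-(\Delta\omega)\eta-\omega\Delta\eta=\mathrm d[\![\omega,\eta]\!]+[\![\mathrm d\omega,\eta]\!]+(-1)^{|\omega|}[\![\omega,\mathrm d\eta]\!]$. It is a cleft extension if $[\![a,\ ]\!]=0$ for all $a\in A$. A cleft extension is regular if $\mathfrak j_\omega(a\,\mathrm db)=\frac12[\![\omega a,b]\!]$ ($\omega\in\Omega$, $a,b\in A$) is a well-defined map $\mathfrak j:\Omega^i\otimes_A\Omega^1\to\Omega^{i-1}$ for all $i$; $\mathfrak j$ is the interior product and its restriction $(\omega,\zeta)=\mathfrak j_\omega(\zeta)$ to $\omega,\zeta\in\Omega^1$ is the metric inner product $(\ ,\ ):\Omega^1\otimes_A\Omega^1\to A$. A bimodule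 covariant derivative with respect to a bimodule map $(\ ,\ )$ is a family of degree-preserving linear maps $\nabla_\omega$ on $\Omega$, linear in $\omega\in\Omega^1$, with $\nabla_{a\omega}=a\nabla_\omega$, $\nabla_\omega(a\eta)=\nabla_{\omega a}\eta+(\omega,\mathrm da)\eta$ and $\nabla_\omega(\eta a)=(\nabla_\omega\eta)a+\sigma_\omega(\eta\otimes_A\mathrm da)$ for some bimodule map $\sigma:\Omega^1\otimes_A\Omega\otimes_A\Omega^1\to\Omega$. $(\ ,\ )$ is invertible with metric $g$ if $g=g^1\otimes g^2\in\Omega^1\otimes_A\Omega^1$ (sum understood) is central ($ag=ga$) and $(\omega,g^1)g^2=\omega=g^1(g^2,\omega)$ for all $\omega\in\Omega^1$. *)

(* Defs.v *)
From HB Require Import structures.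
From mathcomp Require Import all_boot all_algebra.
From mathcomp Require Import ring_quotient boolp freeg.

Set Implicit Arguments.
Unset Strict Implicit.
Unset Printing Implicit Defensive.

Import GRing.Theory.
Local Open Scope ring_scope.
Local Open Scope quotient_scope.

Reserved Notation "a :*> m" (at level 40, left associativity).
Reserved Notation "m <*: a" (at level 40, left associativity).
Reserved Notation "m ⊗ n" (at level 40, left associativity).

(* The last two axioms say that k acts centrally, through k -> A. *)
Record bimod (k : fieldType) (A : algType k) := Bimod {
  bm_sort :> lmodType k;
  lact : A -> bm_sort -> bm_sort;
  ract : bm_sort -> A -> bm_sort;
  lact_linear : forall a, linear (lact a);
  ract_linear : forall a, linear (ract^~ a);
  lactD : forall a b m, lact (a + b) m = lact a m + lact b m;
  ractD : forall a b m, ract m (a + b) = ract m a + ract m b;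
  lactM : forall a b m, lact (a * b) m = lact a (lact b m);
  ractM : forall a b m, ract m (a * b) = ract (ract m a) b;
  lact_ract : forall a b m, lact a (ract m b) = ract (lact a m) b;
  lact_scal : forall (c : k) m, lact c%:A m = c *: m;
  ract_scal : forall (c : k) m, ract m c%:A = c *: m
}.
Notation "a :*> m" := (lact a m) : ring_scope.
Notation "m <*: a" := (ract m a) : ring_scope.

Definition bimod_map (k : fieldType) (A : algType k) (M N : bimod A)
    (f : M -> N) : Prop :=
  [/\ linear f, forall a m, f (a :*> m) = a :*> f m
    & forall m a, f (m <*: a) = f m <*: a].

Section Tensor.
Variables (k : fieldType) (A : algType k) (M N : bimod A).

Local Notation F := {freeg (M * N)%type / k}.
Local Notation gen m n := (<< ((m, n) : M * N) >> : F).

Inductive tens_rel : F -> Prop :=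
| TensRelL (c : k) (m m' : M) (n : N) :
    tens_rel (gen (c *: m + m') n - (c *: gen m n + gen m' n))
| TensRelR (c : k) (m : M) (n n' : N) :
    tens_rel (gen m (c *: n + n') - (c *: gen m n + gen m n'))
| TensRelA (m : M) (a : A) (n : N) :
    tens_rel (gen (m <*: a) n - gen m (a :*> n)).

Definition tens_ideal : {pred F} :=
  fun x => `[< forall P : {pred F}, submod_closed P ->
                 (forall y, tens_rel y -> y \in P) -> x \in P >].

Lemma tens_idealP (x : F) : reflect (forall P : {pred F}, submod_closed P ->
  (forall y, tens_rel y -> y \in P) -> x \in P) (x \in tens_ideal).
Proof. exact: asboolP. Qed.

Lemma tens_ideal_submod : submod_closed tens_ideal.
Proof.
split=> [|c x y /tens_idealP hx /tens_idealP hy]; apply/tens_idealP=> P hP hr.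
  by case: hP.
by case: (hP) => _; apply; [apply: hx | apply: hy].
Qed.

HB.instance Definition _ :=
  GRing.isSubmodClosed.Build k F tens_ideal tens_ideal_submod.

Definition tens_sort := Quotient.quot tens_ideal.
HB.instance Definition _ := GRing.Zmodule.on tens_sort.

Definition tens_pi (x : F) : tens_sort := \pi_(Quotient.quot tens_ideal) x.

Lemma tens_piD x y : tens_pi (x + y) = tens_pi x + tens_pi y.
Proof. exact: (raddfD (\pi_(Quotient.quot tens_ideal))). Qed.

Lemma tens_piE x y : (tens_pi x = tens_pi y) <-> (x - y \in tens_ideal).
Proof.
by rewrite (Quotient.idealrBE tens_ideal); split=> [e|/eqP e]; [apply/eqP|].
Qed.

Lemma tens_reprK (t : tens_sort) : tens_pi (repr t) = t.
Proof. exact: reprK. Qed.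

Definition tens_scale (c : k) (t : tens_sort) : tens_sort :=
  tens_pi (c *: repr t).

Lemma tens_piZ c x : tens_pi (c *: x) = tens_scale c (tens_pi x).
Proof.
apply/tens_piE; rewrite -scalerBr; apply: rpredZ.
by apply/tens_piE; rewrite tens_reprK.
Qed.

Lemma tens_scaleA a b t :
  tens_scale a (tens_scale b t) = tens_scale (a * b) t.
Proof. by rewrite -[t]tens_reprK -!tens_piZ scalerA. Qed.
Lemma tens_scale1 : left_id 1 tens_scale.
Proof. by move=> t; rewrite -[t]tens_reprK -!tens_piZ scale1r. Qed.
Lemma tens_scaleDr : right_distributive tens_scale +%R.
Proof.
move=> c t u; rewrite -[t]tens_reprK -[u]tens_reprK.
by rewrite -!(tens_piD, tens_piZ) scalerDr.
Qed.
Lemma tens_scaleDl t : {morph tens_scale^~ t : a b / a + b}.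
Proof.
by move=> a b; rewrite -[t]tens_reprK -!(tens_piD, tens_piZ) scalerDl.
Qed.

HB.instance Definition _ := GRing.Zmodule_isLmodule.Build k tens_sort
  tens_scaleA tens_scale1 tens_scaleDr tens_scaleDl.

Definition tpure (m : M) (n : N) : tens_sort := tens_pi (gen m n).

Lemma tens_pi_linear : linear tens_pi.
Proof. by move=> c x y; rewrite tens_piD tens_piZ. Qed.
HB.instance Definition _ :=
  GRing.isLinear.Build k F tens_sort _ tens_pi tens_pi_linear.

Lemma tpure_linearl n : linear (tpure^~ n).
Proof.
move=> c m m'; rewrite -linearP; apply/tens_piE/tens_idealP=> P _; apply.
exact: TensRelL.
Qed.
Lemma tpure_linearr m : linear (tpure m).
Proof.
move=> c n n'; rewrite -linearP; apply/tens_piE/tens_idealP=> P _; apply.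
exact: TensRelR.
Qed.
Lemma tpure_balanced m a n : tpure (m <*: a) n = tpure m (a :*> n).
Proof. by apply/tens_piE/tens_idealP=> P _; apply; apply: TensRelA. Qed.

Lemma tens_sum (t : tens_sort) :
  exists s : seq (M * N), t = \sum_(p <- s) tpure p.1 p.2.
Proof.
rewrite -[t]tens_reprK -[repr t]freeg_sumE.
exists [seq (coeff z (repr t) *: z.1, z.2) | z <- dom (repr t)].
rewrite linear_sum [RHS]big_map; apply: eq_bigr => -[m n] _ /=.
rewrite -[_ *: m]addr0 tpure_linearl.
have -> : tpure 0 n = 0.
  by have := tpure_linearl n (-1) 0 0; rewrite scaleN1r oppr0 addr0 scaleN1r addNr.
rewrite addr0 -linearZ; congr tens_pi; apply/eqP/freeg_eqP=> x.
by rewrite coeffZ !coeffU mul1r.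
Qed.

Section Lift.
Variables (V : lmodType k) (f : M -> N -> V).
Definition balanced : Prop :=
  [/\ forall n, linear (f^~ n), forall m, linear (f m)
    & forall m a n, f (m <*: a) n = f m (a :*> n)].

Definition freeg_lift : F -> V := fglift (fun p : M * N => f p.1 p.2).
Definition tens_lift (t : tens_sort) : V := freeg_lift (repr t).

Lemma freeg_liftU c m n : freeg_lift << c *g (m, n) >> = c *: f m n.
Proof. exact: liftU. Qed.

Lemma freeg_lift_zmod : zmod_morphism freeg_lift.
Proof. exact: lift_is_additive. Qed.
HB.instance Definition _ :=
  GRing.isZmodMorphism.Build F V freeg_lift freeg_lift_zmod.

Lemma freeg_lift_linear : linear freeg_lift.
Proof.
move=> c x y; rewrite raddfD; congr (_ + _).
rewrite -[x]freeg_sumE scaler_sumr !raddf_sum.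
apply: eq_bigr => -[m n] _ /=.
have -> : c *: << coeff (m, n) x *g (m, n) >> =
          << (c * coeff (m, n) x) *g (m, n) >> :> F.
  by apply/eqP/freeg_eqP=> w; rewrite coeffZ !coeffU mulrA.
by rewrite !freeg_liftU scalerA.
Qed.
HB.instance Definition _ :=
  GRing.isLinear.Build k F V _ freeg_lift freeg_lift_linear.

Hypothesis fbal : balanced.

Lemma freeg_lift_ideal x : x \in tens_ideal -> freeg_lift x = 0.
Proof.
case: fbal => [fL fR fA] /tens_idealP /(_ (fun x => freeg_lift x == 0)) hx.
apply/eqP/hx => [|y []].
- split=> [|c y z]; rewrite !unfold_in; first by rewrite linear0.
  by move=> /eqP hy /eqP hz; rewrite linearP /= hy hz scaler0 addr0.
- move=> c m m' n.
  by rewrite unfold_in linearB linearP /= !freeg_liftU !scale1r fL subrr.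
- move=> c m n n'.
  by rewrite unfold_in linearB linearP /= !freeg_liftU !scale1r fR subrr.
- move=> m a n.
  by rewrite unfold_in linearB /= !freeg_liftU !scale1r fA subrr.
Qed.

Lemma tens_lift_pi x : tens_lift (tens_pi x) = freeg_lift x.
Proof.
apply/eqP; rewrite -subr_eq0 -linearB; apply/eqP/freeg_lift_ideal.
by apply/tens_piE; rewrite tens_reprK.
Qed.

Lemma tens_lift_linear : linear tens_lift.
Proof.
move=> c t u; rewrite -[t]tens_reprK -[u]tens_reprK -linearP !tens_lift_pi.
exact: linearP.
Qed.

Lemma tens_liftE m n : tens_lift (tpure m n) = f m n.
Proof. by rewrite tens_lift_pi freeg_liftU scale1r. Qed.

End Lift.

Lemma tens_ext (V : lmodType k) (f g : tens_sort -> V) :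
  linear f -> linear g -> (forall m n, f (tpure m n) = g (tpure m n)) -> f =1 g.
Proof.
move=> lf lg fg t.
pose f' := GRing.isLinear.Build k tens_sort V _ f lf.
pose g' := GRing.isLinear.Build k tens_sort V _ g lg.
pose F1 : {linear tens_sort -> V} := HB.pack f f'.
pose G1 : {linear tens_sort -> V} := HB.pack g g'.
rewrite -[f]/(F1 : _ -> _) -[g]/(G1 : _ -> _).
have [s ->] := tens_sum t.
by rewrite !linear_sum; apply: eq_bigr => p _; exact: fg.
Qed.

Definition tens_lact (a : A) : tens_sort -> tens_sort :=
  tens_lift (fun m n => tpure (a :*> m) n).
Definition tens_ract (t : tens_sort) (a : A) : tens_sort :=
  tens_lift (fun m n => tpure m (n <*: a)) t.

Lemma tens_lact_balanced a : balanced (fun m n => tpure (a :*> m) n).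
Proof.
split=> [n c m m'|m c n n'|m b n] /=.
- by rewrite lact_linear tpure_linearl.
- by rewrite tpure_linearr.
- by rewrite lact_ract tpure_balanced.
Qed.

Lemma tens_ract_balanced a : balanced (fun m n => tpure m (n <*: a)).
Proof.
split=> [n c m m'|m c n n'|m b n] /=.
- by rewrite tpure_linearl.
- by rewrite (ract_linear a) tpure_linearr.
- by rewrite -lact_ract tpure_balanced.
Qed.

Lemma tens_lactE a m n : tens_lact a (tpure m n) = tpure (a :*> m) n.
Proof. exact/tens_liftE/tens_lact_balanced. Qed.
Lemma tens_ractE a m n : tens_ract (tpure m n) a = tpure m (n <*: a).
Proof. exact: (tens_liftE (tens_ract_balanced a)). Qed.
Lemma tens_lact_linear a : linear (tens_lact a).
Proof. exact/tens_lift_linear/tens_lact_balanced. Qed.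
Lemma tens_ract_linear a : linear (tens_ract^~ a).
Proof. exact: (tens_lift_linear (tens_ract_balanced a)). Qed.

Let lin_comp (V W : lmodType k) (f : tens_sort -> V) (g : V -> W) :
  linear f -> linear g -> linear (fun t => g (f t)).
Proof. by move=> lf lg c x y; rewrite lf lg. Qed.
Let lin_add (V : lmodType k) (f g : tens_sort -> V) :
  linear f -> linear g -> linear (fun t => f t + g t).
Proof. by move=> lf lg c x y; rewrite lf lg scalerDr addrACA. Qed.
Let lin_scale (c : k) : linear (fun t : tens_sort => c *: t).
Proof. by move=> b x y; rewrite scalerDr !scalerA mulrC. Qed.
Let tpureDl m m' n : tpure (m + m') n = tpure m n + tpure m' n.
Proof. by rewrite -[m in LHS]scale1r tpure_linearl scale1r. Qed.
Let tpureDr m n n' : tpure m (n + n') = tpure m n + tpure m n'.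
Proof. by rewrite -[n in LHS]scale1r tpure_linearr scale1r. Qed.
Let tpureZl c m n : tpure (c *: m) n = c *: tpure m n.
Proof.
rewrite -[_ *: m]addr0 tpure_linearl -[RHS]addr0; congr (_ + _).
by apply: (addrI (tpure 0 n)); rewrite -tpureDl !addr0.
Qed.
Let tpureZr c m n : tpure m (c *: n) = c *: tpure m n.
Proof.
rewrite -[_ *: n]addr0 tpure_linearr -[RHS]addr0; congr (_ + _).
by apply: (addrI (tpure m 0)); rewrite -tpureDr !addr0.
Qed.

Lemma tens_lactD a b t : tens_lact (a + b) t = tens_lact a t + tens_lact b t.
Proof.
move: t; apply: tens_ext => [||m n]; first exact: tens_lact_linear.
  by apply: lin_add; apply: tens_lact_linear.
by rewrite !tens_lactE lactD tpureDl.
Qed.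
Lemma tens_ractD a b t : tens_ract t (a + b) = tens_ract t a + tens_ract t b.
Proof.
move: t; apply: tens_ext => [||m n]; first exact: tens_ract_linear.
  by apply: lin_add; apply: tens_ract_linear.
by rewrite !tens_ractE ractD tpureDr.
Qed.
Lemma tens_lactM a b t : tens_lact (a * b) t = tens_lact a (tens_lact b t).
Proof.
move: t; apply: tens_ext => [||m n]; first exact: tens_lact_linear.
  by apply: lin_comp; apply: tens_lact_linear.
by rewrite !tens_lactE lactM.
Qed.
Lemma tens_ractM a b t : tens_ract t (a * b) = tens_ract (tens_ract t a) b.
Proof.
move: t; apply: tens_ext => [||m n]; first exact: tens_ract_linear.
  by apply: (lin_comp (tens_ract_linear a) (tens_ract_linear b)).
by rewrite !tens_ractE ractM.
Qed.
Lemma tens_lact_ract a b t :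
  tens_lact a (tens_ract t b) = tens_ract (tens_lact a t) b.
Proof.
move: t; apply: tens_ext => [||m n].
- by apply: (lin_comp (tens_ract_linear b) (tens_lact_linear a)).
- by apply: (lin_comp (tens_lact_linear a) (tens_ract_linear b)).
- by rewrite tens_ractE !tens_lactE tens_ractE.
Qed.
Lemma tens_lact_scal (c : k) t : tens_lact c%:A t = c *: t.
Proof.
move: t; apply: tens_ext => [||m n]; first exact: tens_lact_linear.
  exact: lin_scale.
by rewrite tens_lactE lact_scal tpureZl.
Qed.
Lemma tens_ract_scal (c : k) t : tens_ract t c%:A = c *: t.
Proof.
move: t; apply: tens_ext => [||m n]; first exact: tens_ract_linear.
  exact: lin_scale.
by rewrite tens_ractE ract_scal tpureZr.
Qed.

Definition tens : bimod A :=
  @Bimod k A tens_sort tens_lact tens_ract tens_lact_linear tens_ract_linear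
    tens_lactD tens_ractD tens_lactM tens_ractM tens_lact_ract
    tens_lact_scal tens_ract_scal.

Definition tmk (m : M) (n : N) : tens := tpure m n.

End Tensor.
Notation "m ⊗ n" := (tmk m n) : ring_scope.

Section RegularBimod.
Variables (k : fieldType) (A : algType k).

Lemma reg_lact_linear (a : A) : linear (fun m : A => a * m).
Proof. by move=> c x y; rewrite mulrDr scalerAr. Qed.
Lemma reg_ract_linear (a : A) : linear (fun m : A => m * a).
Proof. by move=> c x y; rewrite mulrDl scalerAl. Qed.
Lemma reg_lactD (a b m : A) : (a + b) * m = a * m + b * m.
Proof. exact: mulrDl. Qed.
Lemma reg_ractD (a b m : A) : m * (a + b) = m * a + m * b.
Proof. exact: mulrDr. Qed.
Lemma reg_lactM (a b m : A) : a * b * m = a * (b * m).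
Proof. by rewrite mulrA. Qed.
Lemma reg_ractM (a b m : A) : m * (a * b) = m * a * b.
Proof. exact: mulrA. Qed.
Lemma reg_lact_ract (a b m : A) : a * (m * b) = a * m * b.
Proof. exact: mulrA. Qed.
Lemma reg_lact_scal (c : k) (m : A) : c%:A * m = c *: m.
Proof. exact: mulr_algl. Qed.
Lemma reg_ract_scal (c : k) (m : A) : m * c%:A = c *: m.
Proof. exact: mulr_algr. Qed.

Definition regular_bimod : bimod A :=
  @Bimod k A A (fun a m => a * m) (fun m a => m * a)
    reg_lact_linear reg_ract_linear reg_lactD reg_ractD reg_lactM reg_ractM
    reg_lact_ract reg_lact_scal reg_ract_scal.

End RegularBimod.

(* The grading Ω = ⊕ Ω^n is given by its family of projections: Ω^n is the
   image {w | dga_pr n w = w} of [dga_pr n].  The identification Ω^0 = A is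
   [dga_iota]. *)
Record dga (k : fieldType) (A : algType k) := Dga {
  dga_alg :> algType k;
  dga_pr : nat -> {linear dga_alg -> dga_alg};
  dga_pr_proj : forall m n w,
    dga_pr m (dga_pr n w) = if m == n then dga_pr n w else 0;
  dga_pr_sum : forall w, exists N : nat, w = \sum_(n < N) dga_pr n w;
  dga_mul_deg : forall m n v w, dga_pr m v = v -> dga_pr n w = w ->
    dga_pr (m + n) (v * w) = v * w;
  dga_iota : {lrmorphism A -> dga_alg};
  dga_iota_inj : injective dga_iota;
  dga_iota_im : forall w, dga_pr 0 w = w <-> exists a, w = dga_iota a;
  dga_d : {linear dga_alg -> dga_alg};
  dga_d_deg : forall n w, dga_pr n w = w -> dga_pr n.+1 (dga_d w) = dga_d w;
  dga_leibniz : forall n v w, dga_pr n v = v ->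
    dga_d (v * w) = dga_d v * w + (-1) ^+ n *: (v * dga_d w);
  dga_dd : forall w, dga_d (dga_d w) = 0
}.
Arguments dga_pr {k A d0} n : rename.
Arguments dga_iota {k A d0} : rename.
Arguments dga_d {k A d0} : rename.

Section Forms.
Variables (k : fieldType) (A : algType k) (D : dga A).
Implicit Types (a b : A) (v w : D) (n : nat).

Definition homog n : {pred D} := fun w => dga_pr n w == w.

(* Ω^z for z in ℤ, with Ω^z = 0 for z < 0 *)
Definition homogz (z : int) : {pred D} :=
  match z with Posz n => homog n | Negz _ => pred1 0 end.

Lemma homogP n w : reflect (dga_pr n w = w) (w \in homog n).
Proof. exact: eqP. Qed.

Lemma homog_submod n : submod_closed (homog n).
Proof.
split=> [|c v w /homogP hv /homogP hw]; apply/homogP; first exact: linear0.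
by rewrite linearP /= hv hw.
Qed.
HB.instance Definition _ n :=
  GRing.isSubmodClosed.Build k D (homog n) (homog_submod n).

Lemma homogM m n v w :
  v \in homog m -> w \in homog n -> v * w \in homog (m + n).
Proof. by move=> /homogP hv /homogP hw; apply/homogP/dga_mul_deg. Qed.

Lemma homog_iota a : (dga_iota a : D) \in homog 0.
Proof. by apply/homogP/dga_iota_im; exists a. Qed.

Record form n := Form { form_val :> D; form_deg : form_val \in homog n }.
HB.instance Definition _ n := [isSub for @form_val n].
HB.instance Definition _ n := [Choice of form n by <:].
HB.instance Definition _ n :=
  GRing.SubChoice_isSubLmodule.Build k D (homog n) (form n) (homog_submod n).

Lemma form_lact_deg n a (w : form n) : dga_iota a * form_val w \in homog n.
Proof. exact: (homogM (homog_iota a) (form_deg w)). Qed.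
Lemma form_ract_deg n a (w : form n) : form_val w * dga_iota a \in homog n.
Proof. by have := homogM (form_deg w) (homog_iota a); rewrite addn0. Qed.

Definition form_lact n a (w : form n) : form n := Form (form_lact_deg a w).
Definition form_ract n (w : form n) a : form n := Form (form_ract_deg a w).

Lemma form_lact_linear n a : linear (@form_lact n a).
Proof. by move=> c v w; apply: val_inj; rewrite /= mulrDr scalerAr. Qed.
Lemma form_ract_linear n a : linear ((@form_ract n)^~ a).
Proof. by move=> c v w; apply: val_inj; rewrite /= mulrDl scalerAl. Qed.
Lemma form_lactD n a b (w : form n) :
  form_lact (a + b) w = form_lact a w + form_lact b w.
Proof. by apply: val_inj; rewrite /= rmorphD mulrDl. Qed.
Lemma form_ractD n a b (w : form n) :
  form_ract w (a + b) = form_ract w a + form_ract w b.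
Proof. by apply: val_inj; rewrite /= rmorphD mulrDr. Qed.
Lemma form_lactM n a b (w : form n) :
  form_lact (a * b) w = form_lact a (form_lact b w).
Proof. by apply: val_inj; rewrite /= rmorphM mulrA. Qed.
Lemma form_ractM n a b (w : form n) :
  form_ract w (a * b) = form_ract (form_ract w a) b.
Proof. by apply: val_inj; rewrite /= rmorphM mulrA. Qed.
Lemma form_lact_ract n a b (w : form n) :
  form_lact a (form_ract w b) = form_ract (form_lact a w) b.
Proof. by apply: val_inj; rewrite /= mulrA. Qed.
Lemma form_lact_scal n (c : k) (w : form n) : form_lact c%:A w = c *: w.
Proof. by apply: val_inj; rewrite /= rmorph_alg mulr_algl. Qed.
Lemma form_ract_scal n (c : k) (w : form n) : form_ract w c%:A = c *: w.
Proof. by apply: val_inj; rewrite /= rmorph_alg mulr_algr. Qed.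

Definition forms n : bimod A :=
  @Bimod k A (form n) (@form_lact n) (@form_ract n)
    (@form_lact_linear n) (@form_ract_linear n) (@form_lactD n) (@form_ractD n)
    (@form_lactM n) (@form_ractM n) (@form_lact_ract n)
    (@form_lact_scal n) (@form_ract_scal n).

Lemma all_lact_linear a : linear (fun w => dga_iota a * w).
Proof. by move=> c v w; rewrite mulrDr scalerAr. Qed.
Lemma all_ract_linear a : linear (fun w => w * dga_iota a).
Proof. by move=> c v w; rewrite mulrDl scalerAl. Qed.
Lemma all_lactD a b w :
  dga_iota (a + b) * w = dga_iota a * w + dga_iota b * w.
Proof. by rewrite rmorphD mulrDl. Qed.
Lemma all_ractD a b w :
  w * dga_iota (a + b) = w * dga_iota a + w * dga_iota b.
Proof. by rewrite rmorphD mulrDr. Qed.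
Lemma all_lactM a b w : dga_iota (a * b) * w = dga_iota a * (dga_iota b * w).
Proof. by rewrite rmorphM mulrA. Qed.
Lemma all_ractM a b w : w * dga_iota (a * b) = w * dga_iota a * dga_iota b.
Proof. by rewrite rmorphM mulrA. Qed.
Lemma all_lact_ract a b w :
  dga_iota a * (w * dga_iota b) = dga_iota a * w * dga_iota b.
Proof. exact: mulrA. Qed.
Lemma all_lact_scal (c : k) w : dga_iota c%:A * w = c *: w.
Proof. by rewrite rmorph_alg mulr_algl. Qed.
Lemma all_ract_scal (c : k) w : w * dga_iota c%:A = c *: w.
Proof. by rewrite rmorph_alg mulr_algr. Qed.

Definition all_forms : bimod A :=
  @Bimod k A D (fun a w => dga_iota a * w) (fun w a => w * dga_iota a)
    all_lact_linear all_ract_linear all_lactD all_ractD all_lactM all_ractM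
    all_lact_ract all_lact_scal all_ract_scal.

Lemma d0_deg a : dga_d (dga_iota a : D) \in homog 1.
Proof. by apply/homogP/dga_d_deg/homogP/homog_iota. Qed.
Definition d0 a : forms 1 := Form (d0_deg a).

Definition standard : Prop :=
  (forall w : forms 1, exists s : seq (A * A),
     w = \sum_(p <- s) p.1 :*> d0 p.2) /\
  (forall P : {pred D}, subalg_closed P ->
     (forall a, dga_iota a \in P) -> (forall w : forms 1, form_val w \in P) ->
     forall w, w \in P).

End Forms.
Arguments homog {k A D} n.
Arguments homogz {k A D} z.
Arguments form_val {k A D n} f.
Arguments d0 {k A D} a.

Record cocycle (k : fieldType) (A : algType k) (D : dga A) := Cocycle {
  coc_lap : {linear D -> D};
  coc_br : D -> D -> D;
  coc_lap_deg : forall n w, w \in homog n -> coc_lap w \in homog n;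
  coc_br_bilinear : bilinear_for *:%R *:%R coc_br;
  coc_br_deg : forall m n v w, v \in homog m -> w \in homog n ->
    coc_br v w \in homogz (m%:Z + n%:Z - 1);
  coc_lap_d : forall w, coc_lap (dga_d w) = dga_d (coc_lap w);
  coc_br_cocycle : forall n u v w, u \in homog n ->
    coc_br (u * v) w + coc_br u v * w =
    coc_br u (v * w) + (-1) ^+ n *: (u * coc_br v w);
  coc_lap_cocycle : forall n v w, v \in homog n ->
    coc_lap (v * w) - coc_lap v * w - v * coc_lap w =
    dga_d (coc_br v w) + coc_br (dga_d v) w + (-1) ^+ n *: coc_br v (dga_d w)
}.

Section Riemannian.
Variables (k : fieldType) (A : algType k) (D : dga A) (C : cocycle D).
Implicit Types (a b : A) (w z : forms D 1) (h : D) (n : nat).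

Local Notation Om := (all_forms D).
Local Notation Om1 := (forms D 1).

Definition cleft : Prop := forall a h, coc_br C (dga_iota a) h = 0.

(* The maps Ω^n ⊗_A Ω^1 -> Ω^(n-1) for all n are assembled into one map
   Ω ⊗_A Ω^1 -> Ω of degree -1. *)
Record interior_product (j : tens Om Om1 -> Om) : Prop := {
  intp_linear : linear j;
  intp_deg : forall n h z, h \in homog n ->
    (j ((h : Om) ⊗ z) : D) \in homogz (n%:Z - 1);
  intp_def : forall h a b,
    j ((h : Om) ⊗ (a :*> d0 b)) =
      2^-1 *: coc_br C (h * dga_iota a) (dga_iota b)
}.

Definition regular_cleft : Prop := cleft /\ exists j, interior_product j.

Definition metric_inner_product (j : tens Om Om1 -> Om)
    (ip : tens Om1 Om1 -> regular_bimod A) : Prop :=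
  linear ip /\
  forall w z, dga_iota (ip (w ⊗ z)) = j ((form_val w : Om) ⊗ z).

Record bimod_covariant_derivative (ip : tens Om1 Om1 -> regular_bimod A)
    (nabla : Om1 -> Om -> Om) (sigma : tens (tens Om1 Om) Om1 -> Om) : Prop := {
  bcd_metric : bimod_map ip;
  bcd_sigma : bimod_map sigma;
  bcd_bilinear : bilinear_for *:%R *:%R nabla;
  bcd_deg : forall w n h, h \in homog n -> (nabla w h : D) \in homog n;
  bcd_lact : forall a w (h : Om), nabla (a :*> w) h = a :*> nabla w h;
  bcd_leibnizl : forall w a (h : Om),
    nabla w (a :*> h) = nabla (w <*: a) h + (ip (w ⊗ d0 a) : A) :*> h;
  bcd_leibnizr : forall w a (h : Om),
    nabla w (h <*: a) = nabla w h <*: a + sigma (w ⊗ h ⊗ d0 a)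
}.

Definition half_bracket (w : Om1) (h : Om) : Om :=
  2^-1 *: coc_br C (form_val w) h.

Definition inverse_metric (ip : tens Om1 Om1 -> regular_bimod A)
    (g : tens Om1 Om1) : Prop :=
  (forall a, a :*> g = g <*: a) /\
  exists s : seq (Om1 * Om1),
    [/\ g = \sum_(p <- s) p.1 ⊗ p.2,
        forall w, \sum_(p <- s) (ip (w ⊗ p.1) : A) :*> p.2 = w
      & forall w, \sum_(p <- s) p.1 <*: (ip (p.2 ⊗ w) : A) = w].

End Riemannian.

(* Main.v *)
Require Import Defs.
From HB Require Import structures.
From mathcomp Require Import all_boot all_algebra.
Import GRing.Theory.
Local Open Scope ring_scope.

(* When [[a, ]] = 0 the cocycle identity with an element of A in its first,
   second or third slot says respectively that [[ , ]] is left A-linear, that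
   [[w, a h]] = [[w a, h]] + [[w, a]] h, and that, for w of degree 1,
   [[w, h a]] = [[w, h]] a + [[w h, a]] + w [[h, a]].  Halving and reading
   [[ , a]] / 2 as the interior product with da, these are the three axioms of
   a covariant derivative, with sigma given by the last two terms.  The action
   on tensor products is balanced because moving a across (x) changes its first
   term by sigma_w(h (x) da) (x) z and its second by
   sigma_w(h (x) g^1 (g^2, da)) (x) z, using that g is central; these agree as
   g inverts the inner product. *)

(** * Linearity as a predicate on unbundled functions *)

Section LinearFunctions.
Set Implicit Arguments.
Unset Strict Implicit.
Variables (k : fieldType).

Lemma linear_fun_sum (U V : lmodType k) (f : U -> V) : linear f ->
  forall I (r : seq I) (P : pred I) (F : I -> U),
  f (\sum_(i <- r | P i) F i) = \sum_(i <- r | P i) f (F i).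
Proof.
move=> lf I r P F.
pose F1 : {linear U -> V} := HB.pack f (GRing.isLinear.Build k U V _ f lf).
exact: (linear_sum F1).
Qed.

Lemma linear_funD (U V : lmodType k) (f : U -> V) : linear f ->
  {morph f : x y / x + y}.
Proof. by move=> lf x y; rewrite -[x in LHS]scale1r lf scale1r. Qed.

Lemma linear_fun_comp (U V W : lmodType k) (g : V -> W) (f : U -> V) :
  linear g -> linear f -> linear (fun x => g (f x)).
Proof. by move=> lg lf c x y; rewrite lf lg. Qed.

Lemma linear_fun_add (U V : lmodType k) (f g : U -> V) :
  linear f -> linear g -> linear (fun x => f x + g x).
Proof. by move=> lf lg c x y; rewrite lf lg scalerDr addrACA. Qed.

Lemma linear_fun_scale (U V : lmodType k) (f : U -> V) b :
  linear f -> linear (fun x => b *: f x).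
Proof. by move=> lf c x y; rewrite lf scalerDr !scalerA mulrC. Qed.

Lemma linear_sum_fun (U V : lmodType k) I (r : seq I) (F : I -> U -> V) :
  (forall i, linear (F i)) -> linear (fun x => \sum_(i <- r) F i x).
Proof.
move=> lF c x y; rewrite scaler_sumr -big_split.
by apply: eq_bigr => i _; rewrite lF.
Qed.

End LinearFunctions.

(** * Pure tensors and the universal property of the tensor product over [A] *)

Section TensorMaps.
Set Implicit Arguments.
Unset Strict Implicit.
Variables (k : fieldType) (A : algType k).
Implicit Types (M N P : bimod A).

(** This and the next lemmas recast facts about [tpure] for [⊗], whose values lie in the bimodule
    [tens], so that rewriting sees the actions [:*>] and [<*:]. *)
Lemma tmk_linearl M N (n : N) : linear (fun m : M => m ⊗ n).
Proof. exact: tpure_linearl. Qed.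

Lemma tmk_linearr M N (m : M) : linear (fun n : N => m ⊗ n).
Proof. exact: tpure_linearr. Qed.

Lemma tmk_balanced M N (m : M) a (n : N) : m <*: a ⊗ n = m ⊗ (a :*> n).
Proof. exact: tpure_balanced. Qed.

Lemma tens_lmulE M N a (m : M) (n : N) : a :*> (m ⊗ n) = (a :*> m) ⊗ n.
Proof. exact: tens_lactE. Qed.

Lemma tens_rmulE M N a (m : M) (n : N) : (m ⊗ n) <*: a = m ⊗ (n <*: a).
Proof. exact: tens_ractE. Qed.

Lemma tmk_ext M N (V : lmodType k) (f g : tens M N -> V) :
  linear f -> linear g -> (forall m n, f (m ⊗ n) = g (m ⊗ n)) -> f =1 g.
Proof. exact: tens_ext. Qed.

Lemma tmk_lift M N (V : lmodType k) (f : M -> N -> V) : balanced f ->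
  exists F : tens M N -> V, linear F /\ forall m n, F (m ⊗ n) = f m n.
Proof.
move=> bf; exists (tens_lift f).
by split; [exact: tens_lift_linear | exact: tens_liftE].
Qed.

End TensorMaps.

(** * Extension principles for forms *)

Section Forms.
Set Implicit Arguments.
Unset Strict Implicit.
Variables (k : fieldType) (A : algType k) (D : dga A).

(** The cocycle identities carry a sign and so are stated for homogeneous forms; since every form is
    a finite sum of its components, sign-free consequences extend to all forms. *)
Lemma graded_ext (V : lmodType k) (f g : D -> V) : linear f -> linear g ->
  (forall n h, h \in homog n -> f h = g h) -> f =1 g.
Proof.
move=> lf lg fg h; have [N ->] := dga_pr_sum h.
rewrite !linear_fun_sum //; apply: eq_bigr => i _; apply: (fg i).
by apply/homogP; rewrite dga_pr_proj eqxx.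
Qed.

(** The interior product is prescribed only on forms [a db]; this reduces identities in its second
    argument to them. *)
Lemma standard_ext (V : lmodType k) (f g : forms D 1 -> V) : standard D ->
  linear f -> linear g -> (forall a b, f (a :*> d0 b) = g (a :*> d0 b)) ->
  f =1 g.
Proof.
move=> [sp _] lf lg fg w; have [s ->] := sp w.
by rewrite !linear_fun_sum //; apply: eq_bigr.
Qed.

(** The Leibniz rule brings a right multiple of [a db] back to the shape on which the interior
    product is prescribed. *)
Lemma form_d0M (a b c : A) :
  ((a :*> d0 b) <*: c : forms D 1) = a :*> d0 (b * c) - (a * b) :*> d0 c.
Proof.
apply: val_inj; rewrite /= rmorphM (dga_leibniz (n := 0)).
  by rewrite expr0 scale1r mulrDr rmorphM -!mulrA addrK.
exact/homogP/homog_iota.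
Qed.

End Forms.

(** * The cocycle identity with one argument in [A] *)

Section CleftExtension.
Set Implicit Arguments.
Unset Strict Implicit.
Variables (k : fieldType) (A : algType k) (D : dga A) (C : cocycle D).
Hypothesis cleftC : cleft C.
Local Notation B := (coc_br C).
Local Notation "\i a" := (dga_iota a : D) (at level 8, a at level 2).

Lemma br_linearl h : linear (fun v => B v h).
Proof. exact: (coc_br_bilinear C).1. Qed.

Lemma br_linearr v : linear (B v).
Proof. exact: (coc_br_bilinear C).2. Qed.

Lemma br_lmul a v w : B (\i a * v) w = \i a * B v w.
Proof.
have := coc_br_cocycle C v w (homog_iota D a).
by rewrite !cleftC mul0r addr0 add0r expr0 scale1r.
Qed.

Lemma br_balanced n u a w : u \in homog n ->
  B u (\i a * w) = B (u * \i a) w + B u (\i a) * w.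
Proof.
move=> hu; have := coc_br_cocycle C (\i a) w hu.
by rewrite cleftC mulr0 scaler0 addr0.
Qed.

Lemma br_mulr n u v a : u \in homog n ->
  B u (v * \i a) =
    B u v * \i a + (B (u * v) (\i a) - (-1) ^+ n *: (u * B v (\i a))).
Proof.
move=> hu; have := coc_br_cocycle C v (\i a) hu.
by rewrite addrA [_ * _ + _]addrC => ->; rewrite addrK.
Qed.

(** With functions in the second and third slots the signed term contains [[[a, b]]], which is zero,
    so no homogeneity of [u] is required. *)
Lemma br_fun_mulr u a b :
  B u (\i (a * b)) = B u (\i a) * \i b + B (u * \i a) (\i b).
Proof.
move: u; apply: graded_ext => [||n h hh].
- exact: br_linearl.
- by move=> c x y; rewrite mulrDl -scalerAl !br_linearl mulrDl -scalerAl
    scalerDr addrACA.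
- by rewrite rmorphM (br_mulr _ _ hh) cleftC mulr0 scaler0 subr0.
Qed.

Lemma half_bracket_bilinear :
  bilinear_for *:%R *:%R
    (half_bracket C : forms D 1 -> all_forms D -> all_forms D).
Proof.
split=> x; rewrite /half_bracket; apply: linear_fun_scale.
- by move=> c v w; rewrite -br_linearl.
- exact: br_linearr.
Qed.

Lemma half_bracket_homog (w : forms D 1) n (h : D) : h \in homog n ->
  (half_bracket C w h : D) \in homog n.
Proof.
move=> hh; apply: rpredZ.
(* The degree [1 + n - 1] is an integer; once simplified to [n], [homogz] becomes [homog n]. *)
by have := coc_br_deg C (form_deg w) hh; rewrite addrC addKr.
Qed.

Lemma half_bracket_lmul a (w : forms D 1) (h : all_forms D) :
  half_bracket C (a :*> w) h = a :*> half_bracket C w h.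
Proof. by rewrite /half_bracket /= br_lmul scalerAr. Qed.

(** * Bimodule properties of the interior product and of sigma *)

Section InteriorProduct.
Hypothesis stdD : standard D.
Variable j : tens (all_forms D) (forms D 1) -> all_forms D.
Hypothesis jP : interior_product C j.

Let jlin : linear j := intp_linear jP.

Lemma intp_d0 (h : all_forms D) b :
  j (h ⊗ d0 b) = 2^-1 *: B h (\i b).
Proof.
have <- : 1 :*> d0 b = d0 b :> forms D 1.
  by apply: val_inj; rewrite /= rmorph1 mul1r.
by rewrite (intp_def jP) rmorph1 mulr1.
Qed.

Lemma intp_bimod_map : bimod_map j.
Proof.
split=> [//|a t|t a].
- move: t; apply: tmk_ext => [||h z].
  + exact: (linear_fun_comp jlin (lact_linear a)).
  + exact: (linear_fun_comp (lact_linear a) jlin).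
  rewrite tens_lmulE; move: z; apply: (standard_ext stdD) => [||b c].
  + exact: (linear_fun_comp jlin (tmk_linearr _)).
  + exact: (linear_fun_comp (lact_linear a)
             (linear_fun_comp jlin (tmk_linearr _))).
  + by rewrite !(intp_def jP) /= -mulrA br_lmul scalerAr.
- move: t; apply: tmk_ext => [||h z].
  + exact: (linear_fun_comp jlin (ract_linear a)).
  + exact: (linear_fun_comp (ract_linear a) jlin).
  rewrite tens_rmulE; move: z; apply: (standard_ext stdD) => [||b c].
  + exact: (linear_fun_comp jlin
             (linear_fun_comp (tmk_linearr _) (ract_linear a))).
  + exact: (linear_fun_comp (ract_linear a)
             (linear_fun_comp jlin (tmk_linearr _))).
  (* Here [(b dc) a = b d(ca) - bc da], and [br_fun_mulr] expands [[[hb, ca]]] as [[[hb, c]] a +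
     [[hbc, a]]]; the last term cancels against the contribution of [bc da]. *)
  + rewrite form_d0M -scaleN1r addrC tmk_linearr jlin !(intp_def jP) /=.
    rewrite br_fun_mulr rmorphM mulrA scalerDr scaleN1r.
    by rewrite addrA addrAC addNr add0r scalerAl.
Qed.

(** The formula descends in two stages: to [w ⊗ h] with [z] fixed, by left linearity of [j], and
    then in [z]. For the bimodule property, the left action meets only [w] and the right action only
    [z], where [j] is linear on the respective side. *)
Lemma sigma_exists :
  exists2 sigma : tens (tens (forms D 1) (all_forms D)) (forms D 1) ->
                  all_forms D,
    bimod_map sigma &
    forall (w z : forms D 1) (h : D),
      sigma (w ⊗ (h : all_forms D) ⊗ z) =
        j ((form_val w * h : all_forms D) ⊗ z)
        + (form_val w * (j ((h : all_forms D) ⊗ z) : D) : all_forms D).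
Proof.
have [_ jl jr] := intp_bimod_map.
pose f z (w : forms D 1) (h : all_forms D) : all_forms D :=
  j ((form_val w * h : all_forms D) ⊗ z) + form_val w * (j (h ⊗ z) : D).
pose F z : tens (forms D 1) (all_forms D) -> all_forms D := tens_lift (f z).
have fbal z : balanced (f z).
  split=> [h|w|w a h]; rewrite /f.
  - apply: linear_fun_add.
    + apply: (linear_fun_comp jlin (linear_fun_comp (tmk_linearl _) _)).
      by move=> c x y; rewrite /= mulrDl scalerAl.
    + by move=> c x y; rewrite /= mulrDl scalerAl.
  - apply: linear_fun_add.
    + apply: (linear_fun_comp jlin (linear_fun_comp (tmk_linearl _) _)).
      by move=> c x y; rewrite mulrDr scalerAr.
    + apply: (linear_fun_comp (g := fun x : D => form_val w * x)).
        by move=> c x y; rewrite mulrDr scalerAr.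
      exact: (linear_fun_comp jlin (tmk_linearl _)).
  - by rewrite -tens_lmulE jl /= !mulrA.
have Flin z : linear (F z) := tens_lift_linear (fbal z).
have FE z w h : F z (w ⊗ h) = f z w h := tens_liftE (fbal z) w h.
(* In both terms [h] and [z] meet inside a tensor to which [j] is applied, and that tensor is
   already balanced over [A]. *)
have Gbal : balanced (fun t z => F z t).
  split=> [//|t c z z'|t a z].
  - move: t; apply: tmk_ext => [//||w h].
      exact: (linear_fun_add (linear_fun_scale c (Flin z)) (Flin z')).
    rewrite !FE /f !tmk_linearr !jlin mulrDr -scalerAr scalerDr.
    by rewrite -!addrA; congr (_ + _); rewrite addrCA.
  - move: t; apply: tmk_ext => [|//|w h].
      exact: (linear_fun_comp (Flin z) (ract_linear a)).
    by rewrite tens_rmulE !FE /f -!tmk_balanced /= mulrA.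
have [sigma [slin sE]] := tmk_lift Gbal.
exists sigma => [|w z h]; last by rewrite sE FE.
split=> [//|a t|t a]; move: t.
- apply: tmk_ext => [||t z].
  + exact: (linear_fun_comp slin (lact_linear a)).
  + exact: (linear_fun_comp (lact_linear a) slin).
  rewrite tens_lmulE !sE; move: t; apply: tmk_ext => [||w h].
  + exact: (linear_fun_comp (Flin z) (lact_linear a)).
  + exact: (linear_fun_comp (lact_linear a) (Flin z)).
  rewrite tens_lmulE !FE /f /= -!mulrA mulrDr; congr (_ + _).
  by rewrite -[X in j (X ⊗ _)]/(a :*> (form_val w * h : all_forms D))
    -tens_lmulE jl.
- apply: tmk_ext => [||t z].
  + exact: (linear_fun_comp slin (ract_linear a)).
  + exact: (linear_fun_comp (ract_linear a) slin).
  rewrite tens_rmulE !sE; move: t; apply: tmk_ext => [||w h].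
  + exact: Flin.
  + exact: (linear_fun_comp (ract_linear a) (Flin z)).
  by rewrite !FE /f -!tens_rmulE !jr /= mulrDl mulrA.
Qed.

(** * The half bracket as a bimodule covariant derivative *)

Section Connection.
Variable ip : tens (forms D 1) (forms D 1) -> regular_bimod A.
Hypothesis ipP : metric_inner_product j ip.
Variable sigma :
  tens (tens (forms D 1) (all_forms D)) (forms D 1) -> all_forms D.
Hypothesis sigma_bimod : bimod_map sigma.
Hypothesis sigmaE : forall (w z : forms D 1) (h : D),
  sigma (w ⊗ (h : all_forms D) ⊗ z) =
    j ((form_val w * h : all_forms D) ⊗ z)
    + (form_val w * (j ((h : all_forms D) ⊗ z) : D) : all_forms D).

(** The inner product is [j] seen through [dga_iota], which is injective and multiplicative, so it
    inherits both linearities. *)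
Lemma metric_bimod_map : bimod_map ip.
Proof.
case: ipP => iplin ipE; have [_ jl jr] := intp_bimod_map.
split=> [//|a t|t a]; move: t; apply: tmk_ext => [||w z].
- exact: (linear_fun_comp iplin (lact_linear a)).
- exact: (linear_fun_comp (lact_linear a) iplin).
- apply: (@dga_iota_inj _ _ D); rewrite tens_lmulE ipE.
  rewrite -[form_val _]/(a :*> (form_val w : all_forms D)) -tens_lmulE jl -ipE.
  exact/esym/rmorphM.
- exact: (linear_fun_comp iplin (ract_linear a)).
- exact: (linear_fun_comp (ract_linear a) iplin).
- apply: (@dga_iota_inj _ _ D); rewrite tens_rmulE ipE -tens_rmulE jr -ipE.
  exact/esym/rmorphM.
Qed.

Lemma half_bracket_leibnizl (w : forms D 1) a (h : all_forms D) :
  half_bracket C w (a :*> h) =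
    half_bracket C (w <*: a) h + (ip (w ⊗ d0 a) : A) :*> h.
Proof.
rewrite /half_bracket /= ipP.2 intp_d0 (br_balanced _ _ (form_deg w)).
by rewrite scalerDr scalerAl.
Qed.

Lemma half_bracket_leibnizr (w : forms D 1) a (h : all_forms D) :
  half_bracket C w (h <*: a) =
    half_bracket C w h <*: a + sigma (w ⊗ h ⊗ d0 a).
Proof.
rewrite sigmaE !intp_d0 /half_bracket /= (br_mulr _ _ (form_deg w)).
(* As [w] has degree 1, the sign in [br_mulr] is -1 and its difference becomes the sum defining
   sigma. *)
by rewrite expr1 scaleN1r opprK !scalerDr scalerAl scalerAr.
Qed.

Lemma half_bracket_covariant :
  bimod_covariant_derivative ip (half_bracket C) sigma.
Proof.
split=> //.
- exact: metric_bimod_map.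
- exact: half_bracket_bilinear.
- by move=> w n h; exact: half_bracket_homog.
- exact: half_bracket_lmul.
- exact: half_bracket_leibnizl.
- exact: half_bracket_leibnizr.
Qed.

(** * The action on tensor products *)

Let nabla := half_bracket C : forms D 1 -> all_forms D -> all_forms D.

Lemma sigma_linear_mid (w p : forms D 1) :
  linear (fun h : all_forms D => sigma (w ⊗ h ⊗ p)).
Proof.
have [slin _ _] := sigma_bimod.
exact: (linear_fun_comp slin
         (linear_fun_comp (tmk_linearl _) (tmk_linearr _))).
Qed.

(* Contracting with g through a map on the balanced tensor product makes the
   second term of the formula independent of how g is written as a sum. *)
Lemma sigma_nabla_lift (w : forms D 1) (h z : all_forms D) :
  exists Phi : tens (forms D 1) (forms D 1) ->
               tens (all_forms D) (all_forms D),
    linear Phi /\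
    forall p q, Phi (p ⊗ q) = sigma (w ⊗ h ⊗ p) ⊗ nabla q z.
Proof.
have [slin _ sr] := sigma_bimod; have [nl _] := half_bracket_bilinear.
apply: tmk_lift; split=> [q|p|p a q].
- exact: (linear_fun_comp (tmk_linearl _)
           (linear_fun_comp slin (tmk_linearr _))).
- exact: (linear_fun_comp (tmk_linearr _) (nl z)).
- by rewrite -tens_rmulE sr tmk_balanced /nabla half_bracket_lmul.
Qed.

Lemma nabla_tensor (g : tens (forms D 1) (forms D 1)) :
  inverse_metric ip g ->
  exists nabla2 : forms D 1 -> tens (all_forms D) (all_forms D) ->
                  tens (all_forms D) (all_forms D),
    (forall w, linear (nabla2 w)) /\
    (forall s : seq (forms D 1 * forms D 1),
       g = \sum_(p <- s) p.1 ⊗ p.2 ->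
       forall (w : forms D 1) (h z : all_forms D),
         nabla2 w (h ⊗ z) =
           nabla w h ⊗ z
           + \sum_(p <- s) sigma (w ⊗ h ⊗ p.1) ⊗ nabla p.2 z).
Proof.
move=> [gC [s0 [g0 _ gr]]].
have [slin _ sr] := sigma_bimod; have [nl nr] := half_bracket_bilinear.
(* The formula is written along [s0], a decomposition of [g] known to satisfy the inversion
   identities; other decompositions are compared with it at the end. *)
pose f w (h z : all_forms D) : tens (all_forms D) (all_forms D) :=
  nabla w h ⊗ z + \sum_(p <- s0) sigma (w ⊗ h ⊗ p.1) ⊗ nabla p.2 z.
(* Contracting both sides of [a g = g a] moves [a] from [g^1] to [g^2]. *)
have central w a h z :
    \sum_(p <- s0) sigma (w ⊗ h ⊗ (a :*> p.1)) ⊗ nabla p.2 z =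
    \sum_(p <- s0) sigma (w ⊗ h ⊗ p.1) ⊗ nabla (p.2 <*: a) z.
  have [Phi [lPhi PhiE]] := sigma_nabla_lift w h z.
  have := congr1 Phi (gC a).
  rewrite g0 (linear_fun_sum (lact_linear a)) (linear_fun_sum (ract_linear a)).
  rewrite !(linear_fun_sum lPhi).
  under eq_bigr => p _ do rewrite tens_lmulE PhiE.
  by under [RHS]eq_bigr => p _ do rewrite tens_rmulE PhiE.
(* The coefficient crosses the tensor sign and enters sigma by right linearity, where
   [g^1 (g^2, da) = da]. *)
have inverse w a h z :
    \sum_(p <- s0) sigma (w ⊗ h ⊗ p.1) ⊗ ((ip (p.2 ⊗ d0 a) : A) :*> z) =
    sigma (w ⊗ h ⊗ d0 a) ⊗ z.
  rewrite -[in RHS](gr (d0 a)) (linear_fun_sum (tmk_linearr _)).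
  rewrite (linear_fun_sum slin) (linear_fun_sum (tmk_linearl _)).
  by apply: eq_bigr => p _; rewrite -tens_rmulE sr tmk_balanced.
have fbal w : balanced (f w).
  split=> [z|h|h a z]; rewrite /f.
  - apply: linear_fun_add.
      exact: (linear_fun_comp (tmk_linearl _) (nr w)).
    apply: linear_sum_fun => p.
    exact: (linear_fun_comp (tmk_linearl _) (sigma_linear_mid _ _)).
  - apply: linear_fun_add; first exact: tmk_linearr.
    apply: linear_sum_fun => p.
    exact: (linear_fun_comp (tmk_linearr _) (nr p.2)).
  - rewrite /nabla half_bracket_leibnizr (linear_funD (tmk_linearl z)).
    rewrite tmk_balanced -addrA; congr (_ + _).
    under eq_bigr => p _ do rewrite -tens_rmulE tmk_balanced.
    under [RHS]eq_bigr => p _ do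
      rewrite half_bracket_leibnizl (linear_funD (tmk_linearr _)).
    by rewrite big_split /= -central inverse addrC.
exists (fun w => tens_lift (f w)); split=> [w|s gs w h z].
  exact: tens_lift_linear.
rewrite (tens_liftE (fbal w)) /f; congr (_ + _).
(* The sums along [s0] and [s] are both the value of [Phi] at [g]. *)
have [Phi [lPhi PhiE]] := sigma_nabla_lift w h z.
have := congr1 Phi (etrans (esym g0) gs); rewrite !(linear_fun_sum lPhi).
under eq_bigr => p _ do rewrite PhiE.
by under [RHS]eq_bigr => p _ do rewrite PhiE.
Qed.

End Connection.
End InteriorProduct.
End CleftExtension.

Theorem proposition3p6 (k : fieldType) (A : algType k) (D : dga A)
    (C : cocycle D)
    (j : tens (all_forms D) (forms D 1) -> all_forms D)
    (ip : tens (forms D 1) (forms D 1) -> regular_bimod A) :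
  2%N \notin [pchar k] ->
  standard D ->
  regular_cleft C ->
  interior_product C j ->
  metric_inner_product j ip ->
  bimod_map j /\
  exists sigma :
      tens (tens (forms D 1) (all_forms D)) (forms D 1) -> all_forms D,
    [/\ forall (w z : forms D 1) (h : D),
          sigma (w ⊗ (h : all_forms D) ⊗ z) =
            j ((form_val w * h : all_forms D) ⊗ z)
            + (form_val w * (j ((h : all_forms D) ⊗ z) : D) : all_forms D),
        bimod_covariant_derivative ip (half_bracket C) sigma
      & forall g : tens (forms D 1) (forms D 1), inverse_metric ip g ->
          exists nabla2 : forms D 1 ->
              tens (all_forms D) (all_forms D) ->
              tens (all_forms D) (all_forms D),
            (forall w, linear (nabla2 w)) /\
            (forall s : seq (forms D 1 * forms D 1),
               g = \sum_(p <- s) p.1 ⊗ p.2 ->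
               forall (w : forms D 1) (h z : all_forms D),
                 nabla2 w (h ⊗ z) =
                   half_bracket C w h ⊗ z
                   + \sum_(p <- s)
                       sigma (w ⊗ h ⊗ p.1) ⊗ half_bracket C p.2 z)].
Proof.
move=> _ stdD [cleftC _] jP ipP; split; first exact: intp_bimod_map.
have [sigma sigma_bimod sigmaE] := sigma_exists cleftC stdD jP.
exists sigma; split=> [//||g gP].
  exact: (half_bracket_covariant cleftC stdD jP ipP).
exact: (nabla_tensor cleftC jP ipP sigma_bimod sigmaE gP).
Qed.
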